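(* Let $u$ be a bivariate linear functional, $L^{(a)}(z)=L^{(a)}_nz^n+\dots+L^{(a)}_{-m}z^{-m}$ with $L^{(a)}_nL^{(a)}_{-m}\ne0$, $n,m\in\{0,1,2,\dots\}$, $a\in\{1,2\}$, $\underline n:=\max(n,m)$, and let $\hat u^{(1)}=L^{(1)}(z_1)u$, $\hat u^{(2)}=u\,\overline{L^{(2)}(z_2)}$, where the Gram matrices $G,\hat G^{(1)},\hat G^{(2)}$ are quasidefinite. Let $\omega^{(1)}_1=\hat S^{(1)}_1L^{(1)}(\Upsilon)S_1^{-1}$ and $\omega^{(2)}_2=\hat S^{(2)}_2L^{(2)}(\Upsilon)S_2^{-1}$. Then for $l\ge2\underline n$ $$K^{[l]}(\bar z_1,z_2)=L^{(1)}(z_2)(\hat K^{(1)})^{[l]}(\bar z_1,z_2)-\overline{\big[\hat\phi^{(1)}_{2,l-2\underline n}(z_1),\dots,\hat\phi^{(1)}_{2,l-1}(z_1)\big]}\operatorname{diag}\big((\hat H^{(1)}_{l-2\underline n})^{-1},\dots,(\hat H^{(1)}_{l-1})^{-1}\big)\,W^{(1)}\begin{bmatrix}\phi_{1,l}(z_2)\\ \vdots\\ \phi_{1,l-1+2\underline n}(z_2)\end{bmatrix},$$ $$\overline{K^{[l]}(\bar z_1,z_2)}=L^{(2)}(z_1)\overline{(\hat K^{(2)})^{[l]}(\bar z_1,z_2)}-\overline{\big[\hat\phi^{(2)}_{1,l-2\underline n}(z_2),\dots,\hat\phi^{(2)}_{1,l-1}(z_2)\big]}\,\overline{\operatorname{diag}\big((\hat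 H^{(2)}_{l-2\underline n})^{-1},\dots,(\hat H^{(2)}_{l-1})^{-1}\big)}\,W^{(2)}\begin{bmatrix}\phi_{2,l}(z_1)\\ \vdots\\ \phi_{2,l-1+2\underline n}(z_1)\end{bmatrix},$$ where $W^{(1)}$ and $W^{(2)}$ are the $2\underline n\times2\underline n$ lower triangular matrices $$W^{(1)}=\begin{bmatrix}(\omega^{(1)}_1)_{l-2\underline n,l}&0&\dots&0\\ (\omega^{(1)}_1)_{l-2\underline n+1,l}&(\omega^{(1)}_1)_{l-2\underline n+1,l+1}&\dots&0\\ \vdots&&\ddots&\\ (\omega^{(1)}_1)_{l-1,l}&(\omega^{(1)}_1)_{l-1,l+1}&\dots&(\omega^{(1)}_1)_{l-1,l-1+2\underline n}\end{bmatrix},$$ and $W^{(2)}$ is the same matrix with $\omega^{(1)}_1$ replaced by $\omega^{(2)}_2$.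
   Context: Indices start at $0$. CMV sequence: $\chi(z)=[1,z^{-1},z,z^{-2},z^2,\dots]^\top$. $\Upsilon$ is the semi-infinite permutation matrix with $\Upsilon\chi(z)=z\chi(z)$, i.e. its nonzero entries, all equal to $1$, are $\Upsilon_{2k,2k+2}$, $\Upsilon_{1,0}$, $\Upsilon_{2k+3,2k+1}$ ($k\ge0$); $\Upsilon^{-1}=\Upsilon^\top$, and $L(\Upsilon)=\sum_jL_j\Upsilon^j$. A bivariate linear functional $u=u_{z_1,\bar z_2}$ is a (continuous) linear functional on the span of $f(z_1)\otimes\overline{g(z_2)}:=f(z_1)\overline{g(z_2)}$, $f,g\in\mathbb C[z,z^{-1}]$; $\langle f,g\rangle_u=\langle u,f(z_1)\otimes\overline{g(z_2)}\rangle$; Gram matrix $G_{k,l}=\langle\chi^{(k)},\chi^{(l)}\rangle_u$. Quasidefinite means all leading principal minors are nonzero; then $G=S_1^{-1}H(S_2^{-1})^\dagger$ uniquely with $S_1,S_2$ lower unitriangular and $H=\operatorname{diag}(H_0,H_1,\dots)$ with nonzero entries; $\phi_a(z)=S_a\chi(z)=[\phi_{a,0}(z),\phi_{a,1}(z),\dots]^\top$. The Christoffel–Darboux kernel is $K^{[l]}(\bar z_1,z_2)=\sum_{k=0}^{l-1}\overline{\phi_{2,k}(z_1)}H_k^{-1}\phi_{1,k}(z_2)$. The perturbed functionals are $\langle\hat u^{(1)},f\otimes\bar g\rangle=\langle u,L^{(1)}f\otimes\bar g\rangle$, $\langle\hat u^{(2)},f\otimes\bar g\rangle=\langle u,f\otimes\overline{L^{(2)}g}\rangle$;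 the objects $\hat S^{(a)}_b,\hat H^{(a)}_k,\hat\phi^{(a)}_{b,k},(\hat K^{(a)})^{[l]}$ are those associated in the same way with $\hat u^{(a)}$. *)

(* Defs.v *)
From HB Require Import structures.
From mathcomp Require Import all_boot all_order all_algebra finmap.
From mathcomp Require Import boolp classical_sets fsbigop reals.
From mathcomp Require Import complex.
From mathcomp.multinomials Require Import monalg.

Set Implicit Arguments.
Unset Strict Implicit.
Unset Printing Implicit Defensive.

Import Order.TTheory GRing.Theory Num.Theory.

Local Open Scope classical_set_scope.
Local Open Scope ring_scope.

Section Laurent.
Variable C : numClosedFieldType.

(* C[z, z^-1], encoded by coefficients: f@_k is the coefficient of z^k.  The
   ring structure of malg needs a monoid of exponents without nontrivial
   units, which excludes int; hence the product lmul below. *)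
Definition laurent := {malg C[int]}.

Definition lmul (f g : laurent) : laurent :=
  \sum_(i <- msupp f) \sum_(j <- msupp g) << f@_i * g@_j *g (i + j)%R >>.

(* Meaningful for z != 0 only, since 0^-1 = 0. *)
Definition leval (f : laurent) (z : C) : C :=
  \sum_(k <- msupp f) f@_k * z ^ k.

(* The span of the functions f(z1) * conj(g(z2)): F@_(i, j) is the
   coefficient of z1^i * conj(z2)^j. *)
Definition bilaurent := {malg C[(int * int)%type]}.

Definition tensor (f g : laurent) : bilaurent :=
  \sum_(i <- msupp f) \sum_(j <- msupp g) << f@_i * (g@_j)^* *g (i, j) >>.

Definition has_extreme_exponents (L : laurent) (m n : nat) : Prop :=
  [/\ forall k : int, L@_k != 0 -> - m%:Z <= k <= n%:Z,
      L@_(n%:Z) != 0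
    & L@_(- m%:Z) != 0].

(* [1, z^-1, z, z^-2, z^2, ...] *)
Definition chi (k : nat) : laurent :=
  << (if odd k then - (k.+1)./2%:Z else k./2%:Z) >>.

End Laurent.

Arguments chi {C} k.

Section SemiInfiniteMatrices.
Variable C : numClosedFieldType.

Definition smx := nat -> nat -> C.

(* The sum over all of nat is a finite-support sum, equal to 0 if infinitely
   many terms are nonzero.  This does not occur in the products below: each has
   a left factor with finite rows or a right factor with finite columns. *)
Definition smul (A B : smx) : smx :=
  fun i j => \sum_(k \in [set: nat]) A i k * B k j.

Definition sdiag (d : nat -> C) : smx := fun i j => d i *+ (i == j).
Definition sone : smx := sdiag (fun=> 1).
Definition str (A : smx) : smx := fun i j => A j i.
Definition sadj (A : smx) : smx := fun i j => (A j i)^*.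

(* A lower unitriangular matrix has exactly one right inverse, by forward
   substitution, and it is also a left inverse. *)
Definition sinv (A : smx) : smx :=
  xget (fun _ _ => 0) [set B | smul A B = sone /\ smul B A = sone].

Definition lower_unitriangular (A : smx) : Prop :=
  (forall i j, (i < j)%N -> A i j = 0) /\ (forall i, A i i = 1).

Definition Upsilon : smx := fun i j =>
  [|| ~~ odd i && (j == i.+2), (i == 1%N) && (j == 0%N)
    | odd j && (i == j.+2)]%:R.

Definition Upsilon_exp (j : int) : smx :=
  match j with
  | Posz k => iter k (smul Upsilon) sone
  | Negz k => iter k.+1 (smul (str Upsilon)) sone
  end.

Definition Laurent_Upsilon (L : laurent C) : smx := fun i k =>
  \sum_(j <- msupp L) L@_j * Upsilon_exp j i k.

Definition quasidefinite (G : smx) : Prop :=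
  forall n, \det (\matrix_(i < n, j < n) G i j) != 0.

Definition is_Gauss_Borel (G S1 : smx) (H : nat -> C) (S2 : smx) : Prop :=
  [/\ lower_unitriangular S1, lower_unitriangular S2, forall k, H k != 0
    & G = smul (smul (sinv S1) (sdiag H)) (sadj (sinv S2))].

End SemiInfiniteMatrices.

Section Functionals.
Variable C : numClosedFieldType.
Implicit Types (u : {scalar (bilaurent C)}) (L f g : laurent C).

Definition pairing u f g : C := u (tensor f g).

Definition gram u : smx C := fun k l => pairing u (chi k) (chi l).

Definition is_perturbed1 L u (v : {scalar (bilaurent C)}) : Prop :=
  forall f g, v (tensor f g) = u (tensor (lmul L f) g).

Definition is_perturbed2 L u (v : {scalar (bilaurent C)}) : Prop :=
  forall f g, v (tensor f g) = u (tensor f (lmul L g)).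

Definition phi (S : smx C) (k : nat) : laurent C :=
  \sum_(j \in [set: nat]) S k j *: chi j.

(* The kernel K^[l] with arguments conj(z1) and z2. *)
Definition CDkernel (S1 : smx C) (H : nat -> C) (S2 : smx C) (l : nat)
    (z1 z2 : C) : C :=
  \sum_(k < l) (leval (phi S2 k) z1)^* * (H k)^-1 * leval (phi S1 k) z2.

Definition connection_block (omega : smx C) (N l : nat) : 'M[C]_N :=
  \matrix_(i < N, j < N)
    if (j <= i)%N then omega (l - N + i)%N (l + j)%N else 0.

End Functionals.

(* Main.v *)
Require Import Defs.
From HB Require Import structures.
From mathcomp Require Import all_boot all_order all_algebra finmap.
From mathcomp Require Import boolp classical_sets fsbigop reals.
From mathcomp Require Import complex zify ring.
From mathcomp.multinomials Require Import monalg.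

Set Implicit Arguments.
Unset Strict Implicit.
Unset Printing Implicit Defensive.

Import Order.TTheory GRing.Theory Num.Theory.

Local Open Scope ring_scope.

(** Everything happens at the level of semi-infinite matrices.  Let U be the
    matrix of multiplication by L1 in the basis [chi], that is, L1(Upsilon).

    - Perturbing the functional multiplies the Gram matrix, G1 = U G
      ([gram_perturbed1]).  Inserting the two factorizations into this identity
      gives the connection matrix omega1 a second expression,
      omega1 H = H1 (S2 S12^-1)^dagger ([connection_dual]).  The definition of
      omega1 bounds the distance of its nonzero entries above the diagonal by
      2 max(n, m), since U has that property ([connection_band]); the second
      expression shows that it is upper triangular ([connection_upper]).
    - The definition of omega1 and U chi(z) = L1(z) chi(z) give
      omega1 phi_1(z) = L1(z) phi^_1(z) ([connection_phi1]).  The second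
      expression gives phi_2^dagger H^-1 = phi^_2^dagger H1^-1 omega1
      ([connection_phi2]).
    - Hence the bilinear expression phi^_2^dagger H1^-1 omega1 phi_1, with the
      row index of omega1 cut off at l, is L1 times the perturbed kernel; with
      the column index cut off at l it is the original kernel.  By
      triangularity the two differ by the entries with row index below l and
      column index at least l, and the band condition leaves only the corner
      of size 2 max(n, m), which is the matrix W of the statement
      ([CDkernel_connection]).

    The second formula is the first one for the adjoint problem: G^dagger
    factors as S2^-1 conj(H) (S1^-1)^dagger, the perturbation of the second
    variable acts on it by G2^dagger = L2(Upsilon) G^dagger, and conjugating a
    kernel exchanges the roles of the two families and of z1 and z2. *)

(** * Products of semi-infinite matrices *)

Lemma fsum_nat_ord (V : nmodType) (b : nat) (F : nat -> V) :
  (forall k, (b <= k)%N -> F k = 0) ->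
  \sum_(k \in [set: nat]%classic) F k = \sum_(k < b) F k.
Proof.
move=> F0; rewrite (fsbig_ord _ b F); apply/esym/fsbig_widen => // k [_ /=].
by move=> /negP; rewrite -leqNgt => /F0.
Qed.

Lemma sum_ord_widen (V : nmodType) (b c : nat) (F : nat -> V) :
  (b <= c)%N -> (forall k, (b <= k)%N -> F k = 0) ->
  \sum_(k < c) F k = \sum_(k < b) F k.
Proof.
move=> bc F0; rewrite -!fsum_nat_ord // => k ck.
by rewrite F0 // (leq_trans bc).
Qed.

Section Products.
Variable C : numClosedFieldType.
Implicit Types (A B X : smx C) (a b c : nat -> nat).

(** Associativity of [smul] fails in general; bounds on rows or columns restore
    it by making the double sum finite.  The bound is a function of the row, and
    not merely asserted to exist, so that bounds of products can be computed. *)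
Definition rows_within b A := forall i k, (b i <= k)%N -> A i k = 0.
Definition cols_within c A := rows_within c (str A).

Lemma smul_ord n A B i j :
  (forall k, (n <= k)%N -> A i k * B k j = 0) ->
  smul A B i j = \sum_(k < n) A i k * B k j.
Proof. exact: fsum_nat_ord. Qed.

Lemma smul_rows b A B i j : rows_within b A ->
  smul A B i j = \sum_(k < b i) A i k * B k j.
Proof. by move=> hA; apply: smul_ord => k hk; rewrite hA ?mul0r. Qed.

Lemma smul_cols c A B i j : cols_within c B ->
  smul A B i j = \sum_(k < c j) A i k * B k j.
Proof.
by move=> hB; apply: smul_ord => k hk; rewrite (hB j k hk : B k j = 0) mulr0.
Qed.

Lemma rows_within_smul a b A B : rows_within a A -> rows_within b B ->
  rows_within (fun i => \max_(k < a i) b k)%N (smul A B).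
Proof.
move=> hA hB i j hj; rewrite (smul_rows _ _ _ hA) big1 // => k _.
by rewrite hB ?mulr0 //; apply: leq_trans hj; apply: (leq_bigmax k).
Qed.

Lemma smulA_rows a b A B X : rows_within a A -> rows_within b B ->
  smul (smul A B) X = smul A (smul B X).
Proof.
move=> hA hB; apply/funext => i; apply/funext => j.
rewrite (smul_rows _ _ _ (rows_within_smul hA hB)) (smul_rows _ _ _ hA).
under eq_bigr do rewrite (smul_rows _ _ _ hA) mulr_suml.
rewrite exchange_big /=; apply: eq_bigr => k _.
rewrite (smul_ord (n := \max_(k < a i) b k)%N); last first.
  by move=> p hp; rewrite hB ?mul0r //; apply: leq_trans hp; apply: (leq_bigmax k).
by rewrite mulr_sumr; apply: eq_bigr => p _; rewrite mulrA.
Qed.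

(** The form needed for a product with a Gram matrix in the middle: its rows and
    columns may be full, but the outer factors make all sums finite. *)
Lemma smulA_rows_cols a c A B X : rows_within a A -> cols_within c X ->
  smul (smul A B) X = smul A (smul B X).
Proof.
move=> hA hX; apply/funext => i; apply/funext => j.
rewrite (smul_cols _ _ _ hX) (smul_rows _ _ _ hA).
under eq_bigr do rewrite (smul_rows _ _ _ hA) mulr_suml.
rewrite exchange_big /=; apply: eq_bigr => k _.
rewrite (smul_cols _ _ _ hX) mulr_sumr; apply: eq_bigr => p _.
by rewrite mulrA.
Qed.

Lemma smul_sdiagl d A i j : smul (sdiag d) A i j = d i * A i j.
Proof.
rewrite (smul_ord (n := i.+1)) => [|k hk].
  rewrite big_ord_recr /= /sdiag eqxx mulr1n big1 ?add0r // => k _.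
  by rewrite gtn_eqF // mulr0n mul0r.
by rewrite /sdiag ltn_eqF // mulr0n mul0r.
Qed.

Lemma smul_sdiagr d A i j : smul A (sdiag d) i j = A i j * d j.
Proof.
rewrite (smul_ord (n := j.+1)) => [|k hk].
  rewrite big_ord_recr /= /sdiag eqxx mulr1n big1 ?add0r // => k _.
  by rewrite ltn_eqF // mulr0n mulr0.
by rewrite /sdiag gtn_eqF // mulr0n mulr0.
Qed.

Lemma smul1s A : smul (sone C) A = A.
Proof. by do 2!apply/funext=> ?; rewrite smul_sdiagl mul1r. Qed.

Lemma smuls1 A : smul A (sone C) = A.
Proof. by do 2!apply/funext=> ?; rewrite smul_sdiagr mulr1. Qed.

Lemma sadj_sdiag (d : nat -> C) : sadj (sdiag d) = sdiag (fun k => (d k)^*).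
Proof.
do 2!apply/funext=> ?; rewrite /sadj /sdiag eq_sym rmorphMn /=.
by case: eqP => [->|].
Qed.

Lemma sadj1 : sadj (sone C) = sone C.
Proof. by rewrite sadj_sdiag /= rmorph1. Qed.

Lemma sadjK A : sadj (sadj A) = A.
Proof. by do 2!apply/funext=> ?; rewrite /sadj conjCK. Qed.

Lemma cols_within_sadj b A : rows_within b A -> cols_within b (sadj A).
Proof. by move=> hA i k hk; rewrite /str /sadj hA ?rmorph0. Qed.

Lemma sadj_smul b A B : rows_within b A ->
  sadj (smul A B) = smul (sadj B) (sadj A).
Proof.
move=> hA; do 2!apply/funext=> ?.
rewrite (smul_cols _ _ _ (cols_within_sadj hA)) /sadj (smul_rows _ _ _ hA).
by rewrite rmorph_sum /=; apply: eq_bigr => k _; rewrite rmorphM mulrC.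
Qed.

Definition lower_triangular A := rows_within succn A.

Lemma lower_unitriangular_lower A : lower_unitriangular A -> lower_triangular A.
Proof. by case. Qed.

Lemma lower_triangular_smul A B : lower_triangular A -> lower_triangular B ->
  lower_triangular (smul A B).
Proof.
move=> hA hB i j hj; rewrite (smul_rows _ _ _ hA) big1 // => k _.
by rewrite hB ?mulr0 //; apply: leq_trans hj.
Qed.

Lemma lower_triangular_sdiag d : lower_triangular (sdiag d).
Proof. by move=> i k hk; rewrite /sdiag ltn_eqF. Qed.

(** Forward substitution.  Row p needs all earlier rows; carrying the table of
    the first n rows, with zeros below, makes the recursion structural. *)
Fixpoint inverse_rows A (n : nat) : smx C :=
  if n is p.+1 then fun i j =>
    if i == p then (i == j)%:R - \sum_(k < p) A p k * inverse_rows A p k j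
    else inverse_rows A p i j
  else fun _ _ => 0.

Definition forward_inverse A : smx C := fun i => inverse_rows A i.+1 i.

Lemma inverse_rows_stable A n i : (i < n)%N ->
  inverse_rows A n i = forward_inverse A i.
Proof.
elim: n => // n IH; rewrite ltnS leq_eqVlt => /predU1P[->//|hi].
by apply/funext => j /=; rewrite (ltn_eqF hi) IH.
Qed.

Lemma forward_inverseE A i j : forward_inverse A i j =
  (i == j)%:R - \sum_(k < i) A i k * forward_inverse A k j.
Proof.
rewrite {1}/forward_inverse /= eqxx; congr (_ - _); apply: eq_bigr => k _.
by rewrite inverse_rows_stable.
Qed.

Lemma forward_inverse_unitriangular A : lower_unitriangular (forward_inverse A).
Proof.
have h i j : (i < j)%N -> forward_inverse A i j = 0.
  have [n] := ubnP i; elim: n i => // n IH i /ltnSE hi hj.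
  rewrite forward_inverseE ltn_eqF // sub0r big1 ?oppr0 // => k _.
  by rewrite IH ?mulr0 //; [apply: leq_trans hi | apply: ltn_trans hj].
split=> // i; rewrite forward_inverseE eqxx big1 ?subr0 // => k _.
by rewrite h ?mulr0.
Qed.

Lemma smul_forward_inverse A : lower_unitriangular A ->
  smul A (forward_inverse A) = sone C.
Proof.
case=> hA A1; apply/funext => i; apply/funext => j.
rewrite (smul_rows (b := succn) _ _ _ hA) big_ord_recr /= A1 mul1r.
by rewrite forward_inverseE addrC subrK.
Qed.

(** B = [forward_inverse A] is a right inverse of A and is itself lower
    unitriangular, so it has a right inverse too, which can only be A.  Hence
    two-sided inverses exist, and the one chosen by [sinv] must be B. *)
Lemma sinvE A : lower_unitriangular A ->
  [/\ smul A (sinv A) = sone C, smul (sinv A) A = sone C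
    & lower_triangular (sinv A)].
Proof.
move=> uA; have lA := lower_unitriangular_lower uA.
set B := forward_inverse A; have AB := smul_forward_inverse uA.
have uB : lower_unitriangular B := forward_inverse_unitriangular A.
have lB := lower_unitriangular_lower uB.
have BA : smul B A = sone C.
  have BE := smul_forward_inverse uB.
  suff -> : A = forward_inverse B by [].
  by rewrite -[LHS]smuls1 -BE -(smulA_rows _ lA lB) AB smul1s.
have [AX XA] : smul A (sinv A) = sone C /\ smul (sinv A) A = sone C.
  pose inverses := [set X | smul A X = sone C /\ smul X A = sone C]%classic.
  by apply: (@xgetPex _ _ inverses); exists B.
suff -> : sinv A = B by split.
by rewrite -[LHS]smul1s -BA (smulA_rows _ lB lA) AX smuls1.
Qed.

End Products.

(** * Multiplication by a Laurent polynomial in the CMV ordering *)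

Section Exponents.
Variable C : numClosedFieldType.
Implicit Types (L : laurent C).

(** [chi k] is the monomial of exponent [cmv_exp k].  Since this is a bijection
    from nat to int, Upsilon becomes the shift by 1 on exponents. *)
Definition cmv_exp (k : nat) : int :=
  if odd k then - (k.+1)./2%:Z else k./2%:Z.

Definition exponents_within L m n :=
  forall z, L@_z != 0 -> - m%:Z <= z <= n%:Z.

Definition cmv_index (z : int) : nat :=
  match z with Posz n => n.*2 | Negz n => n.*2.+1 end.

Lemma cmv_indexK : cancel cmv_index cmv_exp.
Proof. by case=> n; rewrite /cmv_exp /= odd_double /= ?uphalf_double ?doubleK. Qed.

Lemma cmv_expK : cancel cmv_exp cmv_index.
Proof.
move=> k; rewrite -[k]odd_double_half; case: (odd k); rewrite ?add1n ?add0n.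
  by rewrite -[_.+1]/(cmv_index (Negz k./2)) cmv_indexK.
by rewrite -[_.*2]/(cmv_index (Posz k./2)) cmv_indexK.
Qed.

Lemma UpsilonE i k : Upsilon C i k = (cmv_exp k == cmv_exp i + 1)%:R.
Proof.
rewrite /Upsilon /cmv_exp; congr ((nat_of_bool _)%:R).
by case oi: (odd i); case ok: (odd k); lia.
Qed.

(** Powers of Upsilon are permutation matrices with rows of this shape, so that
    multiplying by one of them on the left only moves rows. *)
Lemma smul_select (A B : smx C) i k z :
  (forall p, A i p = (cmv_exp p == z)%:R) ->
  smul A B i k = B (cmv_index z) k.
Proof.
move=> hA; have hA' p : A i p = (p == cmv_index z)%:R.
  by rewrite hA -(inj_eq (can_inj cmv_expK)) cmv_indexK.
rewrite (smul_ord (n := (cmv_index z).+1)) => [|p hp].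
  rewrite big_ord_recr /= hA' eqxx mul1r big1 ?add0r // => p _.
  by rewrite hA' ltn_eqF ?mul0r.
by rewrite hA' gtn_eqF ?mul0r.
Qed.

Lemma Upsilon_expE j i k :
  Upsilon_exp C j i k = (cmv_exp k == cmv_exp i + j)%:R.
Proof.
have one p q : sone C p q = (cmv_exp q == cmv_exp p)%:R.
  by rewrite /sone /sdiag (inj_eq (can_inj cmv_expK)) eq_sym.
case: j => t /=.
  elim: t i => [|t IH] i; first by rewrite [LHS]one addr0.
  rewrite iterS (smul_select _ _ (fun p => UpsilonE i p)) IH cmv_indexK.
  by rewrite -addrA -[t.+1]add1n PoszD.
have UT p q : str (Upsilon C) p q = (cmv_exp q == cmv_exp p - 1)%:R.
  by rewrite /str UpsilonE [in RHS]eq_sym subr_eq eq_sym.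
rewrite -iterS NegzE; elim: t.+1 i => {t}[|t IH] i.
  by rewrite [LHS]one oppr0 addr0.
rewrite iterS (smul_select _ _ (UT i)) IH cmv_indexK.
by rewrite -addrA -opprD -[t.+1]add1n PoszD.
Qed.

(** A shift of the exponent by z moves the CMV index up by at most 2 |z|: by
    exactly 2 |z| when it goes away from zero within one sign, and by less
    otherwise. *)
Lemma Laurent_Upsilon_eq0 L m n i k :
  exponents_within L m n ->
  (i + 2 * maxn n m < k)%N -> Laurent_Upsilon L i k = 0.
Proof.
move=> hL hk; rewrite /Laurent_Upsilon big_seq big1 // => z.
rewrite -mcoeff_neq0 => /hL hz; rewrite Upsilon_expE.
case: eqP => [|_]; last by rewrite mulr0.
by rewrite /cmv_exp => e; exfalso; move: e; case: ifP; case: ifP; lia.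
Qed.

(** L(Upsilon) is multiplication by L in disguise: if F z is the value on the
    monomial of exponent z of some map to sequences that is linear, then applying
    L(Upsilon) to its values on the CMV basis yields the values on L times that
    basis.  F is evaluation at a point in one use, and the Gram matrix in the
    other. *)
Lemma smul_Laurent_Upsilon L m n (F : int -> nat -> C) i q :
  exponents_within L m n ->
  smul (Laurent_Upsilon L) (fun p => F (cmv_exp p)) i q =
  \sum_(z <- msupp L) L@_z * F (cmv_exp i + z) q.
Proof.
move=> hL; rewrite (smul_ord (n := (i + 2 * maxn n m).+1)); last first.
  by move=> k hk; rewrite (Laurent_Upsilon_eq0 hL) ?mul0r.
under eq_bigr do rewrite /Laurent_Upsilon mulr_suml.
rewrite exchange_big /= big_seq [RHS]big_seq; apply: eq_bigr => z.
rewrite -mcoeff_neq0 => /hL hz; set k := cmv_index (cmv_exp i + z).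
have hk : (k < (i + 2 * maxn n m).+1)%N.
  rewrite ltnS leqNgt; apply/negP; move: (cmv_indexK (cmv_exp i + z)); rewrite -/k.
  by rewrite /cmv_exp; case: ifP; case: ifP; lia.
rewrite (bigD1 (Ordinal hk)) //= big1 ?addr0.
  by rewrite Upsilon_expE cmv_indexK eqxx mulr1.
move=> p; rewrite -val_eqE /= -(inj_eq (can_inj cmv_expK)) cmv_indexK.
by move=> /negPf hp; rewrite Upsilon_expE hp mulr0 mul0r.
Qed.

End Exponents.

(** * Evaluation and Gram matrices *)

Section Perturbation.
Variable C : numClosedFieldType.
Implicit Types (L f g : laurent C) (u v : {scalar (bilaurent C)}).

(** The column chi(z), as a matrix whose columns are all equal, so that the
    theory of [smul] applies to it. *)
Definition monomials (z : C) : smx C := fun p _ => z ^ cmv_exp p.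

Lemma scale_monomial (K : choiceType) (c : C) (k : K) :
  c *: << k >> = << c *g k >> :> {malg C[K]}.
Proof. by apply/malgP => q; rewrite mcoeffZ !mcoeffU mulrnAr mulr1. Qed.

Lemma scalar_monomial u c k : u << c *g k >> = c * u << k >>.
Proof. by rewrite -scale_monomial linearZ. Qed.

Lemma leval_phi b (S : smx C) k z : rows_within b S ->
  leval (phi S k) z = smul S (monomials z) k 0.
Proof.
move=> hS; rewrite (smul_rows _ _ _ hS) /phi (fsum_nat_ord (b := b k)); last first.
  by move=> p hp; rewrite hS ?scale0r.
rewrite -[leval _ z]/(mmap idfun (fun k => z ^ k) _) raddf_sum /=.
apply: eq_bigr => p _; rewrite /chi -/(cmv_exp p).
by rewrite scale_monomial mmapU.
Qed.

Lemma pairing_chir u f l :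
  pairing u f (chi l) = mmap idfun (fun j => u << (j, cmv_exp l) >>) f.
Proof.
rewrite /pairing /tensor linear_sum; apply: eq_bigr => j _.
rewrite msuppU oner_eq0 big_seq_fset1 mcoeffUU rmorph1 mulr1.
exact: scalar_monomial.
Qed.

Lemma pairing_chil u g k :
  pairing u (chi k) g = mmap Num.conj (fun j => u << (cmv_exp k, j) >>) g.
Proof.
rewrite /pairing /tensor msuppU oner_eq0 big_seq_fset1 mcoeffUU linear_sum.
apply: eq_bigr => j _; rewrite mul1r.
exact: scalar_monomial.
Qed.

Lemma lmul_chi L k : lmul L (chi k) =
  \sum_(j <- msupp L) << L@_j *g j + cmv_exp k >>.
Proof.
apply: eq_bigr => j _.
by rewrite msuppU oner_eq0 big_seq_fset1 mcoeffUU mulr1.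
Qed.

Lemma gram_perturbed1 L m n u v :
  exponents_within L m n -> is_perturbed1 L u v ->
  gram v = smul (Laurent_Upsilon L) (gram u).
Proof.
move=> hL huv; apply/funext => k; apply/funext => l.
rewrite /gram {1}/pairing huv -/(pairing u _ _) pairing_chir lmul_chi.
pose F z q := u << (z, cmv_exp q) >>.
have -> : (fun p q => pairing u (chi p) (chi q)) = fun p => F (cmv_exp p).
  apply/funext => p; apply/funext => q.
  by rewrite pairing_chir /chi mmapU /= mul1r.
rewrite (smul_Laurent_Upsilon F _ _ hL) raddf_sum /=.
by apply: eq_bigr => j _; rewrite mmapU addrC.
Qed.

Lemma gram_perturbed2 L m n u v :
  exponents_within L m n -> is_perturbed2 L u v ->
  sadj (gram v) = smul (Laurent_Upsilon L) (sadj (gram u)).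
Proof.
move=> hL huv; apply/funext => l; apply/funext => k.
rewrite /sadj /gram {1}/pairing huv -/(pairing u _ _) pairing_chil lmul_chi.
pose F z q := (u << (cmv_exp q, z) >>)^*.
have -> : (fun p q => (pairing u (chi q) (chi p))^*) = fun p => F (cmv_exp p).
  apply/funext => p; apply/funext => q.
  by rewrite pairing_chil /chi mmapU /= rmorph1 mul1r.
rewrite (smul_Laurent_Upsilon F _ _ hL) [mmap _ _ _]raddf_sum rmorph_sum /=.
by apply: eq_bigr => j _; rewrite mmapU rmorphM /= conjCK addrC.
Qed.

(** Taking adjoints exchanges the two variables, hence the two families; this is
    what reduces the second perturbation to the first. *)
Lemma is_Gauss_Borel_sadj G S1 H S2 : is_Gauss_Borel G S1 H S2 ->
  is_Gauss_Borel (sadj G) S2 (fun k => (H k : C)^*) S1.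
Proof.
case=> u1 u2 H0 ->.
have [_ _ l1] := sinvE u1; have [_ _ l2] := sinvE u2.
have lD := lower_triangular_sdiag H.
split=> //; first by move=> k; rewrite conjC_eq0.
rewrite (sadj_smul _ (rows_within_smul l1 lD)) sadjK (sadj_smul _ l1) sadj_sdiag.
have lD' := lower_triangular_sdiag (fun k => (H k)^*).
by rewrite (smulA_rows _ l2 lD').
Qed.

(** * The connection matrix *)

Section Connection.
Variables (G G' S1 S1' S2 S2' : smx C) (H H' : nat -> C).
Variables (L : laurent C) (m n : nat).
Hypothesis hL : exponents_within L m n.
Hypothesis GG' : G' = smul (Laurent_Upsilon L) G.
Hypothesis gb : is_Gauss_Borel G S1 H S2.
Hypothesis gb' : is_Gauss_Borel G' S1' H' S2'.
Let omega := smul (smul S1' (Laurent_Upsilon L)) (sinv S1).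
Let N := (2 * maxn n m)%N.

Let u1 : lower_unitriangular S1. Proof. by case: gb. Qed.
Let u2 : lower_unitriangular S2. Proof. by case: gb. Qed.
Let u1' : lower_unitriangular S1'. Proof. by case: gb'. Qed.
Let u2' : lower_unitriangular S2'. Proof. by case: gb'. Qed.
Let l1 := lower_unitriangular_lower u1.
Let l2 := lower_unitriangular_lower u2.
Let l1' := lower_unitriangular_lower u1'.
Let l2' := lower_unitriangular_lower u2'.

Lemma Laurent_Upsilon_rows :
  rows_within (fun i => (i + N).+1) (Laurent_Upsilon L).
Proof. by move=> i k hk; apply: (Laurent_Upsilon_eq0 hL). Qed.

Lemma connection_band j k : (j + N < k)%N -> omega j k = 0.
Proof.
have [_ _ lT1] := sinvE u1.
move=> hk; rewrite /omega (smulA_rows _ l1' Laurent_Upsilon_rows).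
rewrite (smul_rows _ _ _ l1') big1 // => p _.
rewrite (smul_rows _ _ _ Laurent_Upsilon_rows) big1 ?mulr0 // => q _.
rewrite lT1 ?mulr0 //; apply: leq_trans hk; apply: leq_trans (ltn_ord q) _.
by rewrite ltnS leq_add2r -ltnS.
Qed.

(** Multiplying S1^-1 H (S2^-1)^dagger = G by S2^dagger on the right and
    G1 = S1'^-1 H' (S2'^-1)^dagger by S1' on the left,
    omega H = S1' U S1^-1 H = S1' U G S2^dagger = S1' G1 S2^dagger
    = H' (S2'^-1)^dagger S2^dagger. *)
Lemma connection_dual j k :
  omega j k * H k = H' j * (smul S2 (sinv S2') k j)^*.
Proof.
have rU := Laurent_Upsilon_rows.
have [ST1 TS1 lT1] := sinvE u1; have [ST2 TS2 lT2] := sinvE u2.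
have [ST1' TS1' lT1'] := sinvE u1'; have [ST2' TS2' lT2'] := sinvE u2'.
have lD := lower_triangular_sdiag H; have lD' := lower_triangular_sdiag H'.
have [[_ _ _ GE] [_ _ _ GE']] := (gb, gb').
have rSU := rows_within_smul l1' rU.
have cS2 := cols_within_sadj l2.
have lTD := rows_within_smul lT1 lD.
have GS : smul G (sadj S2) = smul (sinv S1) (sdiag H).
  by rewrite GE (smulA_rows_cols _ lTD cS2) -(sadj_smul _ l2) ST2 sadj1 smuls1.
have SG : smul S1' G' = smul (sdiag H') (sadj (sinv S2')).
  have cT2' := cols_within_sadj lT2'.
  rewrite GE' -(smulA_rows_cols _ l1' cT2') -(smulA_rows _ l1' lT1').
  by rewrite ST1' smul1s.
rewrite -smul_sdiagr /omega (smulA_rows _ rSU lT1) -GS.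
rewrite -(smulA_rows_cols _ rSU cS2) (smulA_rows _ l1' rU) -GG' SG.
by rewrite (smulA_rows_cols _ lD' cS2) -(sadj_smul _ l2) smul_sdiagl.
Qed.

(** In [connection_dual], S2 S2'^-1 is lower triangular, so its adjoint is upper
    triangular. *)
Lemma connection_upper j k : (k < j)%N -> omega j k = 0.
Proof.
have [_ _ lT2'] := sinvE u2'; have [_ _ H0 _] := gb.
move=> hk; apply: (mulIf (H0 k)); rewrite mul0r connection_dual.
by rewrite (lower_triangular_smul l2 lT2' hk) rmorph0 mulr0.
Qed.

Lemma smul_Laurent_Upsilon_monomials z i : z != 0 ->
  smul (Laurent_Upsilon L) (monomials z) i 0 = leval L z * z ^ cmv_exp i.
Proof.
move=> z0; rewrite (smul_Laurent_Upsilon (fun t _ => z ^ t) _ _ hL) /leval mulr_suml.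
by apply: eq_bigr => t _; rewrite expfzDr // mulrCA mulrC.
Qed.

(** omega S1 chi(z) = S1' U chi(z) = L(z) S1' chi(z); the sum stops where the
    band of omega does. *)
Lemma connection_phi1 j z : z != 0 ->
  \sum_(k < (j + N).+1) omega j k * leval (phi S1 k) z =
  leval L z * leval (phi S1' j) z.
Proof.
move=> z0; have [ST1 TS1 lT1] := sinvE u1.
have rU := Laurent_Upsilon_rows; have rSU := rows_within_smul l1' rU.
under eq_bigr do rewrite (leval_phi _ _ l1).
rewrite -(smul_ord (B := smul S1 (monomials z))) => [|k hk]; last first.
  by rewrite connection_band ?mul0r.
rewrite /omega -(smulA_rows _ (rows_within_smul rSU lT1) l1).
rewrite (smulA_rows _ rSU lT1) TS1 smuls1 (smulA_rows _ l1' rU).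
rewrite (leval_phi _ _ l1') !(smul_rows _ _ _ l1') mulr_sumr.
by apply: eq_bigr => p _; rewrite smul_Laurent_Upsilon_monomials // mulrCA.
Qed.

(** phi_2 = S2 S2'^-1 phi'_2, and [connection_dual] identifies the coefficients
    with entries of omega; the sum stops at the diagonal. *)
Lemma connection_phi2 k z :
  \sum_(j < k.+1) (leval (phi S2' j) z)^* * (H' j)^-1 * omega j k =
  (leval (phi S2 k) z)^* * (H k)^-1.
Proof.
have [ST2' TS2' lT2'] := sinvE u2'.
have [[_ _ H0 _] [_ _ H0' _]] := (gb, gb').
have lM := lower_triangular_smul l2 lT2'.
have -> : leval (phi S2 k) z =
    \sum_(j < k.+1) smul S2 (sinv S2') k j * leval (phi S2' j) z.
  under eq_bigr do rewrite (leval_phi _ _ l2').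
  rewrite -(smul_rows (smul S2' (monomials z)) _ _ lM) (leval_phi _ _ l2).
  by rewrite -(smulA_rows _ lM l2') (smulA_rows _ l2 lT2') TS2' smuls1.
rewrite rmorph_sum mulr_suml /=; apply: eq_bigr => j _.
apply: (mulIf (H0 k)); rewrite -[_ * _ * H k]mulrA connection_dual rmorphM /=.
have := H0 k; have := H0' j => h' h.
by field; rewrite h h'.
Qed.

(** Both kernels are truncations of phi'_2^dagger H'^-1 omega phi_1: to the rows
    below l, by [connection_phi1], and to the columns below l, by
    [connection_phi2].  The difference is the part of omega in rows below l and
    columns from l on, which the band condition confines to a corner. *)
Lemma CDkernel_connection l z1 z2 : (N <= l)%N -> z2 != 0 ->
  CDkernel S1 H S2 l z1 z2 =
    leval L z2 * CDkernel S1' H' S2' l z1 z2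
    - \sum_(i < N) \sum_(j < N)
        (leval (phi S2' (l - N + i)) z1)^* * (H' (l - N + i)%N)^-1
        * connection_block omega N l i j * leval (phi S1 (l + j)) z2.
Proof.
move=> hl z20; rewrite /CDkernel.
pose a j := (leval (phi S2' j) z1)^* * (H' j)^-1.
pose f k := leval (phi S1 k) z2.
(* By the band condition, l + N columns suffice for every row below l. *)
have row j : (j < l)%N -> leval L z2 * leval (phi S1' j) z2 =
    \sum_(k < l) omega j k * f k + \sum_(k < N) omega j (l + k)%N * f (l + k)%N.
  move=> hj; rewrite -connection_phi1 //.
  rewrite -(@sum_ord_widen _ _ (l + N) (fun k => omega j k * f k)).
  - by rewrite big_split_ord.
  - by rewrite -addSn leq_add2r.
  - by move=> k hk; rewrite connection_band ?mul0r.
(* By triangularity, l rows suffice for every column below l. *)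
have col k : (k < l)%N -> \sum_(j < l) a j * omega j k =
    (leval (phi S2 k) z1)^* * (H k)^-1.
  move=> hk; rewrite -connection_phi2.
  apply: (@sum_ord_widen _ k.+1 l (fun j => a j * omega j k)) => // j hj.
  by rewrite connection_upper ?mulr0.
have -> : leval L z2 * (\sum_(j < l) a j * leval (phi S1' j) z2) =
    \sum_(k < l) (leval (phi S2 k) z1)^* * (H k)^-1 * f k
    + \sum_(j < l) \sum_(k < N) a j * omega j (l + k)%N * f (l + k)%N.
  rewrite mulr_sumr.
  under [in RHS]eq_bigr => k _ do rewrite -col // mulr_suml.
  rewrite [X in _ = X + _]exchange_big /= -big_split /=; apply: eq_bigr => j _.
  rewrite mulrCA row // mulrDr !mulr_sumr.
  by congr (_ + _); apply: eq_bigr => k _; rewrite mulrA.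
rewrite -[LHS]addr0 -addrA; congr (_ + _); apply/esym/eqP; rewrite subr_eq0.
pose T j := \sum_(k < N) a j * omega j (l + k)%N * f (l + k)%N.
apply/eqP; transitivity (\sum_(j < l - N + N) T j); first by rewrite subnK.
rewrite big_split_ord /=.
(* Rows before l - N do not reach column l. *)
rewrite big1 ?add0r => [|j _]; last first.
  rewrite /T big1 // => k _; rewrite connection_band ?mulr0 ?mul0r //.
  by have := ltn_ord j; lia.
apply: eq_bigr => i _; apply: eq_bigr => j _; rewrite mxE.
(* Above the diagonal of the block, column l + j lies outside the band of row
   l - N + i. *)
case: leqP => // hij; rewrite connection_band //; lia.
Qed.

End Connection.

(** * The two connection formulas *)

Lemma CDkernel_conj S1 H S2 l (z1 z2 : C) :
  (CDkernel S1 H S2 l z1 z2)^* = CDkernel S2 (fun k => (H k)^*) S1 l z2 z1.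
Proof.
rewrite /CDkernel rmorph_sum /=; apply: eq_bigr => k _.
by rewrite !rmorphM /= fmorphV conjCK mulrC mulrCA [LHS]mulrC.
Qed.

Lemma conj_diag_mxV N (d : 'I_N -> C) :
  map_mx Num.conj (diag_mx (\row_i (d i)^-1)) = diag_mx (\row_i ((d i)^*)^-1).
Proof.
rewrite map_diag_mx; congr diag_mx.
by apply/rowP => i; rewrite !mxE fmorphV.
Qed.

Lemma mulmx_row_diag_col N (r d c : 'I_N -> C) (W : 'M[C]_N) :
  ((\row_i r i) *m diag_mx (\row_i d i) *m W *m (\col_j c j)) ord0 ord0 =
  \sum_i \sum_j r i * d i * W i j * c j.
Proof.
rewrite mxE exchange_big /=; apply: eq_bigr => j _.
rewrite !mxE mulr_suml; apply: eq_bigr => i _.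
by rewrite mul_mx_diag !mxE.
Qed.

(** Both formulas over an arbitrary numerically closed field: the second is
    [CDkernel_connection] for the adjoint Gram matrices, with z1 and z2
    exchanged. *)
Lemma CDkernel_perturbations
  (u u1 u2 : {scalar (bilaurent C)}) (L1 L2 : laurent C) (n m : nat)
  (hL1 : exponents_within L1 m n) (hL2 : exponents_within L2 m n)
  (hu1 : is_perturbed1 L1 u u1) (hu2 : is_perturbed2 L2 u u2)
  (S1 S2 S11 S12 S21 S22 : smx C) (H H1 H2 : nat -> C)
  (gb : is_Gauss_Borel (gram u) S1 H S2)
  (gb1 : is_Gauss_Borel (gram u1) S11 H1 S12)
  (gb2 : is_Gauss_Borel (gram u2) S21 H2 S22) :
  let omega1 := smul (smul S11 (Laurent_Upsilon L1)) (sinv S1) in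
  let omega2 := smul (smul S22 (Laurent_Upsilon L2)) (sinv S2) in
  let N := (2 * maxn n m)%N in
  forall (l : nat) (z1 z2 : C), (N <= l)%N -> z1 != 0 -> z2 != 0 ->
    CDkernel S1 H S2 l z1 z2 =
      leval L1 z2 * CDkernel S11 H1 S12 l z1 z2
      - ((\row_(i < N) (leval (phi S12 (l - N + i)) z1)^*)
         *m diag_mx (\row_(i < N) (H1 (l - N + i)%N)^-1)
         *m connection_block omega1 N l
         *m (\col_(j < N) leval (phi S1 (l + j)) z2)) ord0 ord0
    /\
    (CDkernel S1 H S2 l z1 z2)^* =
      leval L2 z1 * (CDkernel S21 H2 S22 l z1 z2)^*
      - ((\row_(i < N) (leval (phi S21 (l - N + i)) z2)^*)
         *m map_mx Num.conj (diag_mx (\row_(i < N) (H2 (l - N + i)%N)^-1))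
         *m connection_block omega2 N l
         *m (\col_(j < N) leval (phi S2 (l + j)) z1)) ord0 ord0.
Proof.
move=> omega1 omega2 N l z1 z2 hl z10 z20.
split.
  rewrite mulmx_row_diag_col.
  by rewrite (CDkernel_connection hL1 (gram_perturbed1 hL1 hu1) gb gb1 _ hl z20).
rewrite conj_diag_mxV mulmx_row_diag_col !CDkernel_conj.
by rewrite (CDkernel_connection hL2 (gram_perturbed2 hL2 hu2)
  (is_Gauss_Borel_sadj gb) (is_Gauss_Borel_sadj gb2) _ hl z10).
Qed.

End Perturbation.

Theorem proposition11 (R : realType)
  (u u1 u2 : {scalar (bilaurent R[i])}) (L1 L2 : laurent R[i]) (n m : nat)
  (hL1 : has_extreme_exponents L1 m n) (hL2 : has_extreme_exponents L2 m n)
  (hu1 : is_perturbed1 L1 u u1) (hu2 : is_perturbed2 L2 u u2)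
  (qd : quasidefinite (gram u))
  (qd1 : quasidefinite (gram u1)) (qd2 : quasidefinite (gram u2))
  (* Sba and Hb are the factors \hat S^(b)_a and \hat H^(b) of \hat G^(b) *)
  (S1 S2 S11 S12 S21 S22 : smx R[i]) (H H1 H2 : nat -> R[i])
  (gb : is_Gauss_Borel (gram u) S1 H S2)
  (gb1 : is_Gauss_Borel (gram u1) S11 H1 S12)
  (gb2 : is_Gauss_Borel (gram u2) S21 H2 S22) :
  let omega1 := smul (smul S11 (Laurent_Upsilon L1)) (sinv S1) in
  let omega2 := smul (smul S22 (Laurent_Upsilon L2)) (sinv S2) in
  let N := (2 * maxn n m)%N in
  forall (l : nat) (z1 z2 : R[i]), (N <= l)%N -> z1 != 0 -> z2 != 0 ->
    CDkernel S1 H S2 l z1 z2 =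
      leval L1 z2 * CDkernel S11 H1 S12 l z1 z2
      - ((\row_(i < N) (leval (phi S12 (l - N + i)) z1)^*)
         *m diag_mx (\row_(i < N) (H1 (l - N + i)%N)^-1)
         *m connection_block omega1 N l
         *m (\col_(j < N) leval (phi S1 (l + j)) z2)) ord0 ord0
    /\
    (CDkernel S1 H S2 l z1 z2)^* =
      leval L2 z1 * (CDkernel S21 H2 S22 l z1 z2)^*
      - ((\row_(i < N) (leval (phi S21 (l - N + i)) z2)^*)
         *m map_mx Num.conj (diag_mx (\row_(i < N) (H2 (l - N + i)%N)^-1))
         *m connection_block omega2 N l
         *m (\col_(j < N) leval (phi S2 (l + j)) z1)) ord0 ord0.
Proof.
case: hL1 hL2 => [s1 _ _] [s2 _ _].
exact: (CDkernel_perturbations s1 s2 hu1 hu2 gb gb1 gb2).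
Qed.
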